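(* Let $\mathcal{F}$ be a class of functions $\{\pm1\}^m\to\{\pm1\}$ that is closed under restrictions, and let $\mathcal{G}$ be a class of functions $\{\pm1\}^\ell\to\{\pm1\}$. Let $K\ge1$ be an integer and $a_{\mathrm{out}},b_{\mathrm{out}},a_{\mathrm{in}},b_{\mathrm{in}}>0$, and suppose that for every $1\le k\le K$: (1) $L_{1,k}(f)\le\frac{1-|\mathbb{E}[f]|}{2}\cdot a_{\mathrm{out}}\cdot b_{\mathrm{out}}^k$ for every $f\in\mathcal{F}$, and (2) $L_{1,k}(g)\le\frac{1-|\mathbb{E}[g]|}{2}\cdot a_{\mathrm{in}}\cdot b_{\mathrm{in}}^k$ for every $g\in\mathcal{G}$. Let $f\in\mathcal{F}$, $g_1,\dots,g_m\in\mathcal{G}$, and let $h\colon\{\pm1\}^{m\ell}\to\{\pm1\}$ be their disjoint composition $h(x_{1,1},\dots,x_{m,\ell})=f(g_1(x_{1,1},\dots,x_{1,\ell}),\dots,g_m(x_{m,1},\dots,x_{m,\ell}))$. Then \[ L_{1,K}(h)\le\frac{1-|\mathbb{E}[h]|}{2}\cdot a_{\mathrm{out}}\cdot b_{\mathrm{in}}^K\cdot\frac{a_{\mathrm{in}}b_{\mathrm{out}}}{2}\left(1+\frac{a_{\mathrm{in}}b_{\mathrm{out}}}{2}\right)^{K-1}. \] In particular, when $a_{\mathrm{in}}b_{\mathrm{out}}\ge2$ or $K=1$, $L_{1,K}(h)\le\frac{1-|\mathbb{E}[h]|}{2}\cdot a_{\mathrm{out}}\cdot\frac{(a_{\mathr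m{in}}b_{\mathrm{in}}b_{\mathrm{out}})^K}{2}$.
   Context: For $F\colon\{\pm1\}^N\to\mathbb{R}$ and $S\subseteq[N]$, $\hat F(S)=\mathbb{E}_x[F(x)\prod_{i\in S}x_i]$ for uniform $x\in\{\pm1\}^N$, and $L_{1,k}(F)=\sum_{|S|=k}|\hat F(S)|$; expectations $\mathbb{E}[F]$ are over uniform inputs. A class of functions on $\{\pm1\}^m$ is closed under restrictions if fixing any subset of the input variables to constants in $\{\pm1\}$ yields (viewed as a function of all $m$ variables) a function in the class. The variables of $h$ are indexed by $[m]\times[\ell]$. *)

(* Defs.v *)
From HB Require Import structures.
From mathcomp Require Import all_boot all_order all_algebra.
From mathcomp Require Import classical_sets reals.

Set Implicit Arguments.
Unset Strict Implicit.
Unset Printing Implicit Defensive.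

Import Order.TTheory GRing.Theory Num.Theory.
Local Open Scope ring_scope.

(* A sign in {+1, -1} is encoded by a boolean b standing for (-1) ^+ b, i.e.  *)
(* false is +1 and true is -1; the variables are indexed by a finite type I.  *)
Definition sgnv (R : realType) (b : bool) : R := (-1) ^+ b.
Arguments sgnv R b : clear implicits.

Definition cube (I : finType) : finType := {ffun I -> bool}.

Definition boolfun (I : finType) : finType := {ffun cube I -> bool}.

Definition realfun (R : realType) (I : finType) (f : boolfun I) : cube I -> R :=
  fun x => sgnv R (f x).
Arguments realfun R {I} f x.

Definition expect (R : realType) (I : finType) (F : cube I -> R) : R :=
  (\sum_(x : cube I) F x) / #|cube I|%:R.

Definition fourier (R : realType) (I : finType) (F : cube I -> R)
    (S : {set I}) : R :=
  expect (fun x => F x * \prod_(i in S) sgnv R (x i)).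

Definition L1 (R : realType) (I : finType) (k : nat) (F : cube I -> R) : R :=
  \sum_(S : {set I} | #|S| == k) `|fourier F S|.

Definition restrict_fun (I : finType) (f : boolfun I) (A : {set I})
    (c : cube I) : boolfun I :=
  [ffun x : cube I => f [ffun i => if i \in A then c i else x i]].

Definition closed_under_restrictions (I : finType) (C : set (boolfun I)) : Prop :=
  forall (f : boolfun I) (A : {set I}) (c : cube I),
    C f -> C (restrict_fun f A c).

Definition disjoint_comp (m l : nat) (f : boolfun 'I_m)
    (g : 'I_m -> boolfun 'I_l) : boolfun ('I_m * 'I_l)%type :=
  [ffun x : cube ('I_m * 'I_l)%type => f [ffun i => g i [ffun j => x (i, j)]]].

(* Main.v *)
Require Import Defs.
From mathcomp Require Import all_boot all_order all_algebra.
From mathcomp Require Import classical_sets reals.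
From mathcomp Require Import ring lra.

Set Implicit Arguments.
Unset Strict Implicit.
Unset Printing Implicit Defensive.

Import Order.TTheory GRing.Theory Num.Theory.
Local Open Scope ring_scope.

(* Let mu_i = E[g_i] and let D_J be the J-th partial derivative of the        *)
(* multilinear extension of f at mu. If J is the set of blocks met by S then  *)
(* the Fourier coefficient of h at S is D_J times the product over i in J of  *)
(* those of g_i at S_i, and E[h] is D at the empty set. Summing over the      *)
(* block sizes, which form one of the C(K-1, |J|-1) compositions of K, the    *)
(* bound on the g_i leaves the sums over |J| = k of                           *)
(*   |D_J| prod_(i in J) (1 - |mu_i|).                                        *)
(* These are controlled by a random restriction that fixes coordinate i to    *)
(* the sign of mu_i with probability |mu_i|: the expected J-th Fourier        *)
(* coefficient of the restricted f is D_J prod_(i in J) (1 - |mu_i|), and     *)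
(* 1 - |E[.]| is concave. The binomial theorem then sums over k.              *)

(** The identities for [h] are [fourier_block_comp] and [expect_block_comp], the count of block
    sizes is [coef_prod_le_compositions], and the bound for fixed k is [sum_deriv_le], where closure
    under restrictions enters. Put z = a_in b_out / 2. Each block met costs a_in / 2 through its g_i
    and b_out through f, so the sets J of size k contribute C(K-1, k-1) z^k, and these sum to z (1 +
    z)^(K-1). If z >= 1, then 1 + z <= 2z gives the simpler bound. *)

(** The fibre over [y] is a product of coordinate fibres, so the sum over it factors. It serves both
    the inner functions and the random restriction. *)
Lemma sum_pushforward_prod (R : comNzRingType) (I T U : finType)
    (phi : I -> T -> U) (F : {ffun I -> U} -> R) (t : I -> T -> R) :
  \sum_(z : {ffun I -> T}) F [ffun i => phi i (z i)] * \prod_i t i (z i) =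
  \sum_(y : {ffun I -> U}) F y * \prod_i \sum_(v | phi i v == y i) t i v.
Proof.
rewrite (partition_big (fun z : {ffun I -> T} => [ffun i => phi i (z i)]) xpredT) //=.
apply: eq_bigr => y _; rewrite bigA_distr_big_dep mulr_sumr.
apply: eq_big => [z|z /eqP <- //].
apply/eqP/familyP => [<- i|zy]; first by rewrite unfold_in /= ffunE.
by apply/ffunP => i; rewrite ffunE; apply/eqP/zy.
Qed.

(* The partial derivative along [J] of the multilinear extension of [f], at   *)
(* the point [mu]; for [J] empty, the mean of [f] under the product measure   *)
(* on signs with means [mu].                                                  *)
Definition prod_measure_deriv (R : realType) (I : finType) (f : boolfun I)
    (mu : I -> R) (J : {set I}) : R :=
  \sum_(y : cube I) realfun R f y *
    \prod_i (if i \in J then sgnv R (y i) / 2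
             else (1 + sgnv R (y i) * mu i) / 2).

(** * Characters on a single block *)

Lemma sgnv_indicator (R : realType) (b c : bool) :
  (b == c)%:R = (1 + sgnv R c * sgnv R b) / 2 :> R.
Proof. by case: b; case: c; rewrite /sgnv /= ?expr1 ?expr0; lra. Qed.

Lemma norm_expect_le1 (R : realType) (I : finType) (f : boolfun I) :
  `|expect (realfun R f)| <= 1.
Proof.
have cgt0 : 0 < #|cube I|%:R :> R.
  by rewrite ltr0n; apply/card_gt0P; exists [ffun=> false].
rewrite /expect normrM normfV [`|_%:R|]ger0_norm ?ler0n // ler_pdivrMr // mul1r.
apply: le_trans (ler_norm_sum _ _ _) _.
rewrite (eq_bigr (fun=> 1)) ?sumr_const // => x _.
by rewrite /realfun /sgnv normrX normrN1 expr1n.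
Qed.

Lemma fourier0 (R : realType) (I : finType) (F : cube I -> R) :
  fourier F finset.set0 = expect F.
Proof.
by rewrite /fourier /expect; congr (_ / _); apply: eq_bigr => x _; rewrite big_set0 mulr1.
Qed.

(** Expand the indicator of [g v = c] as (1 + c g(v)) / 2 and use orthogonality of characters. The
    cases [S] empty and nonempty yield the two kinds of factor in [prod_measure_deriv]. *)
Lemma sum_fiber_char (R : realType) (L : finType) (g : boolfun L) (S : {set L})
    (c : bool) :
  \sum_(v : cube L | g v == c) (\prod_(j in S) sgnv R (v j)) / #|cube L|%:R =
  ((S == finset.set0)%:R + sgnv R c * fourier (realfun R g) S) / 2.
Proof.
have cn0 : #|cube L|%:R != 0 :> R.
  by rewrite pnatr_eq0 -lt0n; apply/card_gt0P; exists [ffun=> false].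
have char_sum : \sum_(v : cube L) (\prod_(j in S) sgnv R (v j)) / #|cube L|%:R
    = (S == finset.set0)%:R.
  rewrite -mulr_suml.
  under eq_bigr do rewrite big_mkcond /=.
  rewrite -(bigA_distr_bigA (fun j b => if j \in S then sgnv R b else 1)) /=.
  have [->|[j jS]] := set_0Vmem S.
    rewrite eqxx; under eq_bigr do rewrite big_bool !inE /= -[1 + 1]/(2%:R).
    by rewrite prodr_const -natrX -[2%N]card_bool -card_ffun divff.
  rewrite (bigD1 j) //= big_bool jS /sgnv /= expr1 expr0 addNr mul0r mul0r.
  by case: eqP jS => // ->; rewrite inE.
rewrite -char_sum /fourier /expect mulr_suml mulr_sumr -big_split /= mulr_suml.
rewrite big_mkcond /=; apply: eq_bigr => v _.
rewrite /realfun.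
transitivity ((g v == c)%:R * ((\prod_(j in S) sgnv R (v j)) / #|cube L|%:R)).
  by case: eqP; rewrite ?mul1r ?mul0r.
by rewrite sgnv_indicator; field.
Qed.

(** * Fourier expansion of a disjoint composition *)

Section Composition.
Variables (R : realType) (I L : finType).
Variables (f : boolfun I) (g : I -> boolfun L).

Definition block_comp : boolfun (I * L)%type :=
  [ffun x : cube (I * L)%type => f [ffun i => g i [ffun j => x (i, j)]]].

Definition uncurry_cube (z : {ffun I -> cube L}) : cube (I * L)%type :=
  [ffun p => z p.1 p.2].

Definition union_blocks (s : {ffun I -> {set L}}) : {set I * L} :=
  [set p | p.2 \in s p.1].

Definition blocks_met (s : {ffun I -> {set L}}) : {set I} :=
  [set i | s i != finset.set0].

Lemma uncurry_cube_bij : bijective uncurry_cube.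
Proof.
exists (fun x : cube (I * L)%type => [ffun i => [ffun j => x (i, j)]]) => [z|x].
  by apply/ffunP => i; apply/ffunP => j; rewrite !ffunE.
by apply/ffunP => -[i j]; rewrite !ffunE.
Qed.

Lemma union_blocks_bij : bijective union_blocks.
Proof.
exists (fun S : {set I * L} => [ffun i => [set j | (i, j) \in S]]) => [s|S].
  by apply/ffunP => i; apply/setP => j; rewrite !ffunE !inE.
by apply/setP => -[i j]; rewrite !inE /= ffunE inE.
Qed.

Lemma card_union_blocks (s : {ffun I -> {set L}}) :
  #|union_blocks s| = (\sum_i #|s i|)%N.
Proof.
rewrite -sum1_card; under [RHS]eq_bigr do rewrite -sum1_card.
by rewrite pair_big_dep /=; apply: eq_bigl => p; rewrite inE.
Qed.

Lemma fourier_block_comp (s : {ffun I -> {set L}}) :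
  fourier (realfun R block_comp) (union_blocks s) =
  prod_measure_deriv f (fun i => expect (realfun R (g i))) (blocks_met s) *
  \prod_(i in blocks_met s) fourier (realfun R (g i)) (s i).
Proof.
transitivity (\sum_(z : {ffun I -> cube L}) realfun R f [ffun i => g i (z i)] *
    \prod_i ((\prod_(j in s i) sgnv R (z i j)) / #|cube L|%:R)).
  rewrite /fourier /expect (reindex _ (onW_bij _ uncurry_cube_bij)) /= mulr_suml.
  apply: eq_bigr => z _; rewrite -mulrA; congr (_ * _).
    rewrite /realfun /block_comp ffunE; congr (sgnv R (f _)).
    apply/ffunP => i; rewrite !ffunE; congr (g i _).
    by apply/ffunP => j; rewrite !ffunE.
  rewrite big_split /= prodr_const.
  congr (_ * _).
    rewrite pair_big_dep /=; apply: eq_big => [p|p _]; first by rewrite inE.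
    by rewrite ffunE.
  rewrite exprVn -natrX; congr (_%:R^-1).
  by rewrite !card_ffun card_prod mulnC expnM.
rewrite (sum_pushforward_prod (fun i v => g i v) (realfun R f)
  (fun i v => (\prod_(j in s i) sgnv R (v j)) / #|cube L|%:R)).
rewrite mulr_suml; apply: eq_bigr => y _; rewrite -mulrA; congr (_ * _).
rewrite [X in _ * X]big_mkcond -big_split /=; apply: eq_bigr => i _.
rewrite sum_fiber_char inE; case: eqP => [->|_] /=.
  by rewrite mulr1 fourier0.
by rewrite add0r mulrAC.
Qed.

Lemma expect_block_comp :
  expect (realfun R block_comp) =
  prod_measure_deriv f (fun i => expect (realfun R (g i))) finset.set0.
Proof.
have := fourier_block_comp [ffun=> finset.set0].
have -> : union_blocks [ffun=> finset.set0] = finset.set0.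
  by apply/setP => p; rewrite !inE ffunE inE.
have -> : blocks_met [ffun=> finset.set0] = finset.set0.
  by apply/setP => i; rewrite !inE ffunE eqxx.
by rewrite fourier0 big_set0 mulr1.
Qed.

(** The polynomial is a generating function: the exponent of ['X] records block sizes, so its
    coefficient at [k] collects the families meeting exactly the blocks of [J] with total size
    [k]. *)
Lemma L1_block_comp (k : nat) :
  L1 k (realfun R block_comp) =
  \sum_(J : {set I})
    `|prod_measure_deriv f (fun i => expect (realfun R (g i))) J| *
    (\prod_(i in J) \sum_(S : {set L} | S != finset.set0)
        `|fourier (realfun R (g i)) S| *: 'X^#|S|)`_k.
Proof.
rewrite /L1 (reindex _ (onW_bij _ union_blocks_bij)) /=.
rewrite (partition_big blocks_met xpredT) //=; apply: eq_bigr => J _.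
(* Blocks outside [J] are given the empty set with weight 1, so that distributing the product ranges
   over full families. *)
rewrite [X in polyseq X](_ : _ = \prod_i \sum_(S : {set L} | (S != finset.set0) == (i \in J))
   (if i \in J then `|fourier (realfun R (g i)) S| else 1) *: 'X^#|S|); last first.
  rewrite [LHS]big_mkcond /=; apply: eq_bigr => i _; case: (i \in J).
    by apply: eq_bigl => S; rewrite eqb_id.
  by rewrite (big_pred1 finset.set0) ?cards0 ?scale1r // => S; rewrite eqbF_neg negbK.
rewrite bigA_distr_big_dep coef_sum mulr_sumr.
have fam (s : {ffun I -> {set L}}) :
    (s \in family (fun i (S : {set L}) => (S != finset.set0) == (i \in J))) =
    (blocks_met s == J).
  apply/familyP/eqP => [sJ|<- i]; last by apply/eqP; rewrite inE.
  by apply/setP => i; rewrite inE; exact: eqP (sJ i).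
under eq_bigl do rewrite card_union_blocks andbC.
under [RHS]eq_bigl do rewrite fam.
rewrite big_mkcondr /=; apply: eq_bigr => s /eqP sJ.
rewrite scaler_prod prodrXr coefZ coefXn eq_sym.
case: eqP => _; last by rewrite mulr0 mulr0.
by rewrite fourier_block_comp sJ mulr1 normrM normr_prod [X in _ * X = _]big_mkcond.
Qed.

End Composition.

(* The number of ways to write [n] as an ordered sum of [j] positive integers. *)
Definition num_compositions (n j : nat) : nat :=
  match n, j with
  | 0, _ => (j == 0)%N
  | n'.+1, 0 => 0
  | n'.+1, j'.+1 => 'C(n', j')
  end.

Lemma sum_num_compositions (n j : nat) :
  (\sum_(k < n.+1) num_compositions k j)%N = 'C(n, j).
Proof.
elim: n j => [|n IHn] j; first by rewrite big_ord1; case: j.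
by rewrite big_ord_recr /= IHn; case: j => [|j]; rewrite ?bin0 ?binS ?addn0 // addnC.
Qed.

(** By induction on [s]: the new factor takes a positive degree, the powers of [b] multiply, and the
    counts for the remaining degree add up by [sum_num_compositions]. *)
Lemma coef_prod_le_compositions (R : realFieldType) (I : Type) (s : seq I)
    (P : I -> {poly R}) (c : I -> R) (b : R) (K : nat) :
  0 <= b -> (forall i, 0 <= c i) -> (forall i, (P i)`_0 = 0) ->
  (forall i k, (1 <= k <= K)%N -> 0 <= (P i)`_k <= c i * b ^+ k) ->
  forall n, (n <= K)%N ->
    0 <= (\prod_(i <- s) P i)`_n <=
      \prod_(i <- s) c i * b ^+ n * (num_compositions n (size s))%:R.
Proof.
move=> b0 c0 P0 Pk; elim: s => [|i s IHs] n nK.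
  rewrite !big_nil coef1 mul1r; case: n nK => [|n] _ /=; first by rewrite expr0 mulr1 ler01 lexx.
  by rewrite mulr0 lexx.
(* The term leaving degree zero to the new factor vanishes by [P0]. *)
rewrite !big_cons coefMr big_ord_recr /= subnn P0 mul0r addr0.
case: n nK => [|n] nK; first by rewrite big_ord0 mulr0 lexx.
rewrite [size _]/= [num_compositions _ _]/= -sum_num_compositions natr_sum mulr_sumr.
have jK (j : 'I_n.+1) : (j <= K)%N by apply: leq_trans nK; apply: ltnW (ltn_ord j).
have njK (j : 'I_n.+1) : (1 <= n.+1 - j <= K)%N.
  by rewrite subn_gt0 ltn_ord (leq_trans (leq_subr _ _)).
have PI (j : 'I_n.+1) := Pk i _ (njK j).
have QI (j : 'I_n.+1) := IHs j (jK j).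
apply/andP; split; first apply: sumr_ge0 => j _.
  by have /andP[? _] := PI j; have /andP[? _] := QI j; apply: mulr_ge0.
apply: ler_sum => j _.
have /andP[p0 p1] := PI j; have /andP[q0 q1] := QI j.
apply: le_trans (ler_pM p0 q0 p1 q1) _.
have -> : b ^+ n.+1 = b ^+ (n.+1 - j) * b ^+ j by rewrite -exprD subnK // ltnW.
by rewrite le_eqVlt; apply/orP; left; apply/eqP; ring.
Qed.

Lemma big_bool_cond (V : nmodType) (Q : pred bool) (F : bool -> V) :
  \sum_(b | Q b) F b =
  (if Q true then F true else 0) + (if Q false then F false else 0).
Proof. by rewrite big_mkcond big_bool. Qed.

(** * Random restriction towards the signs of the means *)

Section RandomRestriction.
Variables (R : realType) (I : finType) (f : boolfun I) (mu : I -> R).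

(* Under this product weight, coordinate [i] is fixed to the sign of [mu i]   *)
(* with probability [`|mu i|] and left free otherwise, so that a uniform      *)
(* completion of the free coordinates has mean [mu].                          *)
Definition restriction_weight (A : cube I) : R :=
  \prod_i (if A i then `|mu i| else 1 - `|mu i|).

Definition sign_restriction (A : cube I) : boolfun I :=
  restrict_fun f [set i | A i] [ffun i => mu i < 0].

Lemma sum_restriction_weight : \sum_A restriction_weight A = 1.
Proof.
rewrite -(bigA_distr_bigA (fun i a => if a then `|mu i| else 1 - `|mu i|)) /=.
by rewrite big1 // => i _; rewrite big_bool /=; ring.
Qed.

(** Coordinates are independent. A fixed one in [J] contributes 0 because its character averages
    out, which leaves the factor 1 - |mu_i|; outside [J], mixing fixed and free gives a sign of mean
    mu_i. *)
Lemma mean_fourier_restriction (J : {set I}) :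
  \sum_A restriction_weight A * fourier (realfun R (sign_restriction A)) J =
  prod_measure_deriv f mu J * \prod_(i in J) (1 - `|mu i|).
Proof.
have fourierE A : fourier (realfun R (sign_restriction A)) J =
    \sum_(y : cube I) realfun R f y *
      \prod_i \sum_(b : bool | (if A i then mu i < 0 else b) == y i)
         (if i \in J then sgnv R b else 1) / 2.
  rewrite -(sum_pushforward_prod (fun i b => if A i then mu i < 0 else b)
    (realfun R f) (fun i b => (if i \in J then sgnv R b else 1) / 2)).
  rewrite /fourier /expect mulr_suml; apply: eq_bigr => x _.
  rewrite -mulrA; congr (_ * _).
    rewrite /realfun /sign_restriction ffunE; congr (sgnv R (f _)).
    by apply/ffunP => i; rewrite !ffunE inE.
  rewrite big_split /= -big_mkcond prodr_const exprVn -natrX.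
  by rewrite card_ffun card_bool.
under [LHS]eq_bigr => A _ do rewrite fourierE mulr_sumr.
rewrite exchange_big mulr_suml /=; apply: eq_bigr => y _.
under eq_bigr do rewrite mulrCA -big_split /=.
rewrite -mulr_sumr -mulrA; congr (_ * _).
rewrite -(bigA_distr_bigA (fun i a => (if a then `|mu i| else 1 - `|mu i|) *
  \sum_(b : bool | (if a then mu i < 0 else b) == y i)
         (if i \in J then sgnv R b else 1) / 2)) /=.
rewrite [X in _ * X]big_mkcond -big_split /=; apply: eq_bigr => i _.
rewrite big_bool !big_bool_cond /=.
have [mu0|mu0] := ltP (mu i) 0; rewrite ?(ltr0_norm mu0) ?(ger0_norm mu0);
  by case: (i \in J); case: (y i); rewrite /sgnv /= ?expr1 ?expr0; field.
Qed.

(** The triangle inequality is used twice: to bound the left side by the average of [L1 k] over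
    restrictions, and to bound |D at the empty set| by the average of the absolute means. *)
Lemma sum_deriv_le (k : nat) (C : R) :
  (forall i, `|mu i| <= 1) -> 0 <= C ->
  (forall A, L1 k (realfun R (sign_restriction A)) <=
     (1 - `|expect (realfun R (sign_restriction A))|) / 2 * C) ->
  \sum_(J : {set I} | #|J| == k)
     `|prod_measure_deriv f mu J| * \prod_(i in J) (1 - `|mu i|) <=
  (1 - `|prod_measure_deriv f mu finset.set0|) / 2 * C.
Proof.
move=> mu1 C0 HL.
have w0 A : 0 <= restriction_weight A.
  by apply: prodr_ge0 => i _; case: (A i); rewrite ?subr_ge0.
have D0 : `|prod_measure_deriv f mu finset.set0| <=
    \sum_A restriction_weight A * `|expect (realfun R (sign_restriction A))|.
  have := mean_fourier_restriction finset.set0; rewrite big_set0 mulr1 => <-.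
  apply: le_trans (ler_norm_sum _ _ _) _; apply: ler_sum => A _.
  by rewrite normrM ger0_norm // fourier0.
apply: (@le_trans _ _ (\sum_A restriction_weight A *
    L1 k (realfun R (sign_restriction A)))).
  rewrite /L1; under [leRHS]eq_bigr do rewrite mulr_sumr.
  rewrite exchange_big /=; apply: ler_sum => J _.
  rewrite -[X in _ * X]ger0_norm; last by apply: prodr_ge0 => i _; rewrite subr_ge0.
  rewrite -normrM -mean_fourier_restriction.
  apply: le_trans (ler_norm_sum _ _ _) _; apply: ler_sum => A _.
  by rewrite normrM ger0_norm.
apply: (@le_trans _ _ (\sum_A restriction_weight A *
    ((1 - `|expect (realfun R (sign_restriction A))|) / 2 * C))).
  by apply: ler_sum => A _; rewrite ler_wpM2l.
under eq_bigr do rewrite !mulrA mulrBr mulr1.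
rewrite -!mulr_suml sumrB sum_restriction_weight.
by rewrite !ler_wpM2r // ?lerD2l ?lerN2 // invr_ge0 ler0n.
Qed.

End RandomRestriction.

(** * Assembling the bound *)

Lemma sum_compositions_binomial (R : realFieldType) (K : nat) (z : R) :
  \sum_(k < K.+2) (num_compositions K.+1 k)%:R * z ^+ k = z * (1 + z) ^+ K.
Proof.
rewrite big_ord_recl /= mul0r add0r exprDn mulr_sumr; apply: eq_bigr => k _.
by rewrite expr1n mul1r -mulr_natl exprS; ring.
Qed.

Lemma L1_block_comp_le (R : realType) (I L : finType) (K : nat)
    (f : boolfun I) (g : I -> boolfun L) (a_out b_out a_in b_in : R) :
  0 <= a_out -> 0 <= b_out -> 0 <= a_in -> 0 <= b_in ->
  (forall k A c, (1 <= k <= K.+1)%N ->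
     L1 k (realfun R (restrict_fun f A c)) <=
     (1 - `|expect (realfun R (restrict_fun f A c))|) / 2 * a_out * b_out ^+ k) ->
  (forall k i, (1 <= k <= K.+1)%N ->
     L1 k (realfun R (g i)) <=
     (1 - `|expect (realfun R (g i))|) / 2 * a_in * b_in ^+ k) ->
  L1 K.+1 (realfun R (block_comp f g)) <=
    (1 - `|expect (realfun R (block_comp f g))|) / 2 * a_out * b_in ^+ K.+1 *
    (a_in * b_out / 2) * (1 + a_in * b_out / 2) ^+ K.
Proof.
move=> ao0 bo0 ai0 bi0 Hf Hg.
set mu := fun i => expect (realfun R (g i)).
have mu1 i : `|mu i| <= 1 by apply: norm_expect_le1.
set D := prod_measure_deriv f mu.
set z := a_in * b_out / 2.
have Jbound (J : {set I}) :
    (\prod_(i in J) \sum_(S : {set L} | S != finset.set0)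
        `|fourier (realfun R (g i)) S| *: 'X^#|S|)`_K.+1 <=
    (a_in / 2) ^+ #|J| * \prod_(i in J) (1 - `|mu i|) * b_in ^+ K.+1 *
    (num_compositions K.+1 #|J|)%:R.
  rewrite -big_enum cardE.
  have := @coef_prod_le_compositions R I (enum J)
    (fun i => \sum_(S : {set L} | S != finset.set0)
        `|fourier (realfun R (g i)) S| *: 'X^#|S|)
    (fun i => a_in / 2 * (1 - `|mu i|)) b_in K.+1 bi0.
  case/(_ _ _ _ K.+1 (leqnn _))/andP => [i|i|i k k1|_ /le_trans->//].
  - by rewrite mulr_ge0 ?divr_ge0 ?subr_ge0 ?ler0n.
  - rewrite coef_sum big1 // => S S0.
    by rewrite coefZ coefXn eq_sym cards_eq0 (negbTE S0) mulr0.
  - set p := _`_k.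
    (* Since [k] is positive, omitting the empty set changes nothing. *)
    have -> : p = L1 k (realfun R (g i)).
      rewrite /p coef_sum /L1 [LHS]big_mkcond [RHS]big_mkcond /=.
      apply: eq_bigr => S _; rewrite coefZ coefXn.
      have [->|_] := eqVneq S finset.set0; last by rewrite eq_sym; case: eqP; rewrite ?mulr1 ?mulr0.
      by rewrite cards0 /=; case: (0 =P k) k1 => [<-|].
    rewrite sumr_ge0 //=; apply: le_trans (Hg k i k1) _.
    by rewrite le_eqVlt -/(mu i); apply/orP; left; apply/eqP; ring.
  by rewrite big_split /= big_const_seq count_predT iter_mulr_1 big_enum.
rewrite L1_block_comp -/mu expect_block_comp -/mu -/D.
apply: (@le_trans _ _ (\sum_(J : {set I}) b_in ^+ K.+1 *
   ((a_in / 2) ^+ #|J| * (num_compositions K.+1 #|J|)%:R *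
   (`|D J| * \prod_(i in J) (1 - `|mu i|))))).
  apply: ler_sum => J _; apply: le_trans (ler_wpM2l (normr_ge0 _) (Jbound J)) _.
  by rewrite le_eqVlt; apply/orP; left; apply/eqP; rewrite -/D; ring.
rewrite -mulr_sumr.
(* [K.+1] has no composition into more than [K.+1] parts. Discarding larger [J] also makes [inord]
   exact below. *)
rewrite (bigID (fun J : {set I} => #|J| < K.+2)%N) /= [X in _ * (_ + X)]big1 ?addr0; last first.
  move=> J; rewrite -leqNgt => JK.
  by case: #|J| JK => //= j jK; rewrite bin_small // mulr0 mul0r.
rewrite (partition_big (fun J : {set I} => inord #|J| : 'I_K.+2) xpredT) //=.
have -> : (1 - `|D finset.set0|) / 2 * a_out * b_in ^+ K.+1 * z * (1 + z) ^+ K =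
  b_in ^+ K.+1 * \sum_(k < K.+2) (num_compositions K.+1 k)%:R * z ^+ k *
     ((1 - `|D finset.set0|) / 2 * a_out).
  by rewrite -mulr_suml sum_compositions_binomial; ring.
rewrite ler_wpM2l ?exprn_ge0 //; apply: ler_sum => k _.
have Jk (J : {set I}) : ((#|J| < K.+2)%N && (inord #|J| == k)) = (#|J| == k).
  apply/andP/eqP => [[JK /eqP <-]|Jk]; first by rewrite inordK.
  by rewrite Jk ltn_ord inord_val.
rewrite (eq_bigl _ _ Jk).
rewrite (eq_bigr (fun J : {set I} => (a_in / 2) ^+ k * (num_compositions K.+1 k)%:R *
   (`|D J| * \prod_(i in J) (1 - `|mu i|)))); last by move=> J /eqP ->.
rewrite -mulr_sumr; case: k {Jk} => -[|k] kK /=; first by rewrite mulr0 !mul0r.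
apply: le_trans (ler_wpM2l _ (@sum_deriv_le R I f mu k.+1 (a_out * b_out ^+ k.+1) mu1 _ _)) _.
- by rewrite mulr_ge0 ?exprn_ge0 ?divr_ge0 ?ler0n.
- by rewrite mulr_ge0 ?exprn_ge0.
- by move=> A; rewrite mulrA; apply: Hf.
rewrite -/D le_eqVlt; apply/orP; left; apply/eqP.
by rewrite /z [a_in * b_out / 2]mulrAC [(_ * b_out) ^+ _]exprMn; ring.
Qed.

Theorem theorem6p1 (R : realType) (m l : nat)
    (calF : set (boolfun 'I_m)) (calG : set (boolfun 'I_l))
    (K : nat) (a_out b_out a_in b_in : R)
    (f : boolfun 'I_m) (g : 'I_m -> boolfun 'I_l) :
  closed_under_restrictions calF ->
  (1 <= K)%N ->
  0 < a_out -> 0 < b_out -> 0 < a_in -> 0 < b_in ->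
  (forall k : nat, (1 <= k <= K)%N ->
     (forall f' : boolfun 'I_m, calF f' ->
        L1 k (realfun R f') <=
          (1 - `|expect (realfun R f')|) / 2 * a_out * b_out ^+ k) /\
     (forall g' : boolfun 'I_l, calG g' ->
        L1 k (realfun R g') <=
          (1 - `|expect (realfun R g')|) / 2 * a_in * b_in ^+ k)) ->
  calF f ->
  (forall i : 'I_m, calG (g i)) ->
  let h := realfun R (disjoint_comp f g) in
  L1 K h <= (1 - `|expect h|) / 2 * a_out * b_in ^+ K
            * (a_in * b_out / 2) * (1 + a_in * b_out / 2) ^+ (K - 1)%N /\
  (2 <= a_in * b_out \/ K = 1%N ->
   L1 K h <= (1 - `|expect h|) / 2 * a_out
             * ((a_in * b_in * b_out) ^+ K / 2)).
Proof.
move=> Fclosed; case: K => // K _ ao0 bo0 ai0 bi0 Hfg Ff Gg h.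
have main : L1 K.+1 h <= (1 - `|expect h|) / 2 * a_out * b_in ^+ K.+1
            * (a_in * b_out / 2) * (1 + a_in * b_out / 2) ^+ K.
  apply: L1_block_comp_le; rewrite ?ltW // => k.
    by move=> A c kK; apply: (Hfg k kK).1; apply: Fclosed.
  by move=> i kK; apply: (Hfg k kK).2.
rewrite subn1; split=> // large; apply: le_trans main _.
set z := a_in * b_out / 2.
have z0 : 0 <= z by rewrite divr_ge0 ?mulr_ge0 ?ltW ?ler0n.
(* After the case split [K] stands for the original exponent minus one, so the case of degree 1
   compares zeroth powers. *)
have step : (1 + z) ^+ K <= (2 * z) ^+ K.
  case: large => [z1|[->]]; last by rewrite !expr0.
  have z1' : 1 <= z by rewrite ler_pdivlMr ?mul1r ?ltr0n.
  by rewrite lerXn2r ?nnegrE; lra.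
have -> : a_in * b_in * b_out = b_in * (2 * z) by rewrite /z; field.
rewrite exprMn [(2 * z) ^+ K.+1]exprS.
apply: le_trans (ler_wpM2l _ step) _.
  by rewrite !mulr_ge0 ?exprn_ge0 ?subr_ge0 ?norm_expect_le1 ?invr_ge0 ?ler0n // ltW.
by rewrite le_eqVlt; apply/orP; left; apply/eqP; field.
Qed.
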